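(* Let $k$ be an algebraically closed field of characteristic $0$ and let $n\ge 1$. If $X\subseteq \mathbb{P}^n_k$ is the union of $l$ hyperplanes with $1\le l\le n$, then $X$ is $\mathbb{L}$-rational, i.e. $[X]\equiv 1 \pmod{\mathbb{L}}$ in $K_0(\mathrm{Var}_k)$.
   Context: $K_0(\mathrm{Var}_k)$ is the Grothendieck ring of varieties over $k$: the abelian group generated by isomorphism classes $[X]$ of $k$-varieties (not necessarily irreducible), modulo $[X]=[Y]+[X\setminus Y]$ for every closed subvariety $Y\subseteq X$, with product $[X]\cdot[Y]=[X\times_k Y]$. $\mathbb{L}=[\mathbb{A}^1_k]$. A $k$-variety $X$ is called $\mathbb{L}$-rational if $[X]-1$ lies in the ideal $(\mathbb{L})\subset K_0(\mathrm{Var}_k)$. Zero loci in projective space are considered as sets of zeros (reduced structure). *)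

(* Defs.v *)
From HB Require Import structures.
From mathcomp Require Import all_boot all_order all_algebra.
From mathcomp Require Import all_classical.
From mathcomp Require Import topology.
(* The notations of mpoly and topology clash. *)
From mathcomp Require Import -(notations) mpoly.

Set Implicit Arguments.
Unset Strict Implicit.
Unset Printing Implicit Defensive.

Import GRing.Theory.

Local Open Scope classical_set_scope.
Local Open Scope ring_scope.

(* Varieties over an algebraically closed field k, i.e. reduced separated     *)
(* k-schemes of finite type, are treated classically (Serre, Mumford, Kempf): *)
(* topological spaces with a sheaf of k-valued functions, having a finite     *)
(* open cover by affine algebraic sets, and separated. The points are the     *)
(* closed points of the scheme; irreducibility is not required.               *)

(* A function on an open set U is given by a total function, of which only    *)
(* the restriction to U matters (regular_ext).                                *)
Record fspace (k : closedFieldType) := Fspace {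
  fspace_top :> topologicalType;
  regular : set fspace_top -> (fspace_top -> k) -> Prop;
  regular_ext : forall U f g, open U -> (forall x, U x -> f x = g x) ->
    regular U f -> regular U g;
  regular_cover : forall (C : set (set fspace_top)) f,
    (forall U, C U -> open U) ->
    regular (\bigcup_(U in C) U) f <-> (forall U, C U -> regular U f);
  regular_cst : forall U (c : k), open U -> regular U (fun=> c);
  regularD : forall U f g, open U -> regular U f -> regular U g ->
    regular U (fun x => f x + g x);
  regularM : forall U f g, open U -> regular U f -> regular U g ->
    regular U (fun x => f x * g x);
  regular_open : forall U f, open U -> regular U f ->
    open (U `&` [set x | f x != 0]);
  regularV : forall U f, open U -> regular U f ->
    regular (U `&` [set x | f x != 0]) (fun x => (f x)^-1)
}.
Arguments regular {k X} U f : rename.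

Section Morphisms.
Variable k : closedFieldType.
Implicit Types X Y : fspace k.

Definition is_morphism X Y (phi : X -> Y) : Prop :=
  continuous phi /\
  forall V f, open V -> regular V f -> regular (phi @^-1` V) (f \o phi).

Definition isomorphic X Y : Prop :=
  exists (phi : X -> Y) (psi : Y -> X),
    [/\ is_morphism phi, is_morphism psi, cancel phi psi & cancel psi phi].

Lemma is_morphism_id X : is_morphism (id : X -> X).
Proof. by split=> // x. Qed.

Lemma isomorphic_refl X : isomorphic X X.
Proof. by exists id, id; split=> //; exact: is_morphism_id. Qed.

End Morphisms.

(* The structure induced on an arbitrary subset A of X: the functions that    *)
(* are locally restrictions of regular functions of X. For A closed this is   *)
(* the reduced structure.                                                     *)
Section Induced.
Variables (k : closedFieldType) (X : fspace k) (A : set X).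

Definition induced_regular (W : set (set_type A)) (f : set_type A -> k) :=
  forall x, W x -> exists (V : set X) (g : X -> k),
    [/\ open V, V (val x), regular V g &
        forall y, W y -> V (val y) -> f y = g (val y)].

Let regularI (U V : set X) f :
  open U -> open V -> regular U f -> regular (U `&` V) f.
Proof.
move=> oU oV rf; have oUV := openI oU oV.
have e : \bigcup_(W in [set U; U `&` V]) W = U.
  by rewrite bigcup_setU !bigcup_set1; apply/setUidPl; exact: subIsetl.
have := @regular_cover _ X [set U; U `&` V] f; rewrite e => /(_ _).
by case=> [W [->|->]//|+ _] => /(_ rf); apply; right.
Qed.

Let openP (T : topologicalType) (U : set T) :
  (forall x, U x -> exists V, [/\ open V, V x & V `<=` U]) -> open U.
Proof.
move=> h; rewrite openE => x /h[V [oV Vx VU]].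
by apply: filterS VU _; exact: open_nbhs_nbhs.
Qed.

Let open_val (V : set X) : open V -> open (val @^-1` V : set (set_type A)).
Proof. by move=> oV; exists V. Qed.

Fact induced_regular_ext W f g : open W -> (forall x, W x -> f x = g x) ->
  induced_regular W f -> induced_regular W g.
Proof.
move=> _ fg rf x Wx; have [V [h [oV Vx rh fh]]] := rf x Wx.
by exists V, h; split=> // y Wy Vy; rewrite -fg// fh.
Qed.

Fact induced_regular_cover (C : set (set (set_type A))) f :
  (forall W, C W -> open W) ->
  induced_regular (\bigcup_(W in C) W) f <->
  (forall W, C W -> induced_regular W f).
Proof.
move=> oC; split=> [rf W CW x Wx|rf x [W CW Wx]].
  have [|V [h [oV Vx rh fh]]] := rf x; first by exists W.
  by exists V, h; split=> // y Wy; apply: fh; exists W.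
have [V [h [oV Vx rh fh]]] := rf _ CW x Wx.
have [V' oV' eW] := oC _ CW.
exists (V `&` V'), h; split.
- exact: openI.
- by split=> //; move: Wx; rewrite -eW.
- exact: regularI.
- by move=> y _ [Vy V'y]; apply: fh => //; rewrite -eW.
Qed.

Fact induced_regular_cst W c : open W -> induced_regular W (fun=> c).
Proof.
move=> _ x Wx; exists setT, (fun=> c); split=> //; first exact: openT.
by apply: regular_cst; exact: openT.
Qed.

Let induced_regular2 (op : k -> k -> k) W f g :
  (forall U (u v : X -> k), open U -> regular U u -> regular U v ->
    regular U (fun x => op (u x) (v x))) ->
  induced_regular W f -> induced_regular W g ->
  induced_regular W (fun x => op (f x) (g x)).
Proof.
move=> rop rf rg x Wx; have [V [u [oV Vx ru fu]]] := rf x Wx.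
have [V' [v [oV' V'x rv gv]]] := rg x Wx.
have oVV := openI oV oV'.
exists (V `&` V'), (fun x => op (u x) (v x)); split=> //.
  apply: rop => //; first exact: regularI.
  by rewrite setIC; apply: regularI.
by move=> y Wy [Vy V'y]; rewrite fu// gv.
Qed.

Fact induced_regularD W f g : open W -> induced_regular W f ->
  induced_regular W g -> induced_regular W (fun x => f x + g x).
Proof. by move=> _; apply: induced_regular2 => *; exact: regularD. Qed.

Fact induced_regularM W f g : open W -> induced_regular W f ->
  induced_regular W g -> induced_regular W (fun x => f x * g x).
Proof. by move=> _; apply: induced_regular2 => *; exact: regularM. Qed.

Fact induced_regular_open W f : open W -> induced_regular W f ->
  open (W `&` [set x | f x != 0]).
Proof.
move=> oW rf; apply: openP => x [Wx fx0].
have [V [g [oV Vx rg fg]]] := rf x Wx.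
exists (W `&` val @^-1` (V `&` [set z | g z != 0])); split.
- by apply: openI => //; apply: open_val; exact: regular_open.
- by split=> //; split=> //=; rewrite -fg.
- by move=> y [Wy [Vy gy]]; split=> //=; rewrite fg.
Qed.

Fact induced_regularV W f : open W -> induced_regular W f ->
  induced_regular (W `&` [set x | f x != 0]) (fun x => (f x)^-1).
Proof.
move=> oW rf x [Wx fx0]; have [V [g [oV Vx rg fg]]] := rf x Wx.
exists (V `&` [set z | g z != 0]), (fun z => (g z)^-1); split.
- exact: regular_open.
- by split=> //=; rewrite -fg.
- exact: regularV.
- by move=> y [Wy _] [Vy _]; rewrite fg.
Qed.

Definition induced : fspace k :=
  Fspace induced_regular_ext induced_regular_cover induced_regular_cst
    induced_regularD induced_regularM induced_regular_open induced_regularV.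

End Induced.

(* A common description of the affine and the projective space. The functions *)
(* of degree d are, for the affine space, all polynomial functions (for every *)
(* d) and, for the projective space, the homogeneous polynomials of degree d  *)
(* evaluated at a chosen generator of the line x. Closed sets are the common  *)
(* zero loci of such functions, and regular functions are locally quotients   *)
(* u / v with u and v of the same degree; for the projective space neither    *)
(* depends on the choice of the generator.                                    *)
Record gradedFunctions (k : closedFieldType) := GradedFunctions {
  gr_point : choiceType;
  gr : nat -> set (gr_point -> k);
  gr_cst : forall c : k, gr 0%N (fun=> c);
  grD : forall d f g, gr d f -> gr d g -> gr d (fun x => f x + g x);
  grM : forall d e f g, gr d f -> gr e g -> gr (d + e)%N (fun x => f x * g x)
}.

Section Zariski.
Variables (k : closedFieldType) (G : gradedFunctions k).

Definition zariski_point : Type := gr_point G.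
HB.instance Definition _ := Choice.on zariski_point.
Local Notation T := zariski_point.
Implicit Types (U V : set T) (f g : T -> k).

Definition homogeneous f := exists d, gr d f.

Definition zariski_open U := exists2 S : set (T -> k),
  (forall f, S f -> homogeneous f) &
  ~` U = [set x | forall f, S f -> f x = 0].

Let zopenE U : zariski_open U <->
  (forall x, U x -> exists f,
     [/\ homogeneous f, f x != 0 & [set y | f y != 0] `<=` U]).
Proof.
split=> [[S hS eU] x Ux|h].
  have : ~ (~` U) x by [].
  rewrite eU => /existsNP[f /not_implyP[Sf /eqP fx0]].
  exists f; split=> //; first exact: hS.
  move=> y /= fy0; apply: contrapT => nUy.
  have /(_ f Sf) e : [set z | forall g, S g -> g z = 0] y by rewrite -eU.
  by rewrite e eqxx in fy0.
exists [set f | homogeneous f /\ [set y | f y != 0] `<=` U].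
  by move=> f [].
apply/seteqP; split=> x /= => [nUx f [_ fU]|fx0 /h[f [hf fx fU]]].
  by apply/eqP; apply: contra_notT nUx => /fU.
by move: fx; rewrite (fx0 f)// eqxx.
Qed.

Fact zariski_openT : zariski_open setT.
Proof.
apply/zopenE => x _; exists (fun=> 1); split=> //; last exact: oner_neq0.
by exists 0%N; exact: gr_cst.
Qed.

Fact zariski_openI : setI_closed zariski_open.
Proof.
move=> U V /zopenE hU /zopenE hV; apply/zopenE => x [Ux Vx].
have [f [[d hf] fx fU]] := hU x Ux; have [g [[e hg] gx gV]] := hV x Vx.
exists (fun y => f y * g y); split.
- by exists (d + e)%N; exact: grM.
- by rewrite mulf_neq0.
- by move=> y /=; rewrite mulf_eq0 negb_or => /andP[/fU + /gV].
Qed.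

Fact zariski_open_bigU (I : Type) (F : I -> set T) :
  (forall i, zariski_open (F i)) -> zariski_open (\bigcup_i F i).
Proof.
move=> oF; apply/zopenE => x [i _ Fix].
have /zopenE/(_ x Fix)[f [hf fx fF]] := oF i.
by exists f; split=> // y /fF Fiy; exists i.
Qed.

HB.instance Definition _ := isOpenTopological.Build T
  zariski_openT zariski_openI zariski_open_bigU.

Let openP U :
  (forall x, U x -> exists V, [/\ open V, V x & V `<=` U]) -> open U.
Proof.
move=> h; rewrite openE => x /h[V [oV Vx VU]].
by apply: filterS VU _; exact: open_nbhs_nbhs.
Qed.

Let open_neq0 f : homogeneous f -> open [set x | f x != 0].
Proof. by move=> hf; apply/zopenE => x fx; exists f; split. Qed.

Definition zariski_regular U f := forall x, U x ->
  exists V d (u v : T -> k),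
    [/\ open V, V x, gr d u, gr d v &
        forall y, U y -> V y -> v y != 0 /\ f y = u y / v y].

Fact zariski_regular_ext U f g : open U -> (forall x, U x -> f x = g x) ->
  zariski_regular U f -> zariski_regular U g.
Proof.
move=> _ fg rf x Ux; have [V [d [u [v [oV Vx hu hv fuv]]]]] := rf x Ux.
by exists V, d, u, v; split=> // y Uy; rewrite -fg//; exact: fuv.
Qed.

Fact zariski_regular_cover (C : set (set T)) f : (forall U, C U -> open U) ->
  zariski_regular (\bigcup_(U in C) U) f <->
  (forall U, C U -> zariski_regular U f).
Proof.
move=> oC; split=> [rf U CU x Ux|rf x [U CU Ux]].
  have [|V [d [u [v [oV Vx hu hv fuv]]]]] := rf x; first by exists U.
  by exists V, d, u, v; split=> // y Uy; apply: fuv; exists U.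
have [V [d [u [v [oV Vx hu hv fuv]]]]] := rf _ CU x Ux.
exists (U `&` V), d, u, v; split=> //; first by apply: openI => //; exact: oC.
by move=> y _ [Uy Vy]; exact: fuv.
Qed.

Fact zariski_regular_cst U c : open U -> zariski_regular U (fun=> c).
Proof.
move=> _ x Ux; exists setT, 0%N, (fun=> c), (fun=> 1).
split=> //; [exact: openT|exact: gr_cst|exact: gr_cst|].
by move=> y _ _; rewrite oner_neq0 divr1.
Qed.

Fact zariski_regularD U f g : open U -> zariski_regular U f ->
  zariski_regular U g -> zariski_regular U (fun x => f x + g x).
Proof.
move=> _ rf rg x Ux; have [V [d [u [v [oV Vx hu hv fuv]]]]] := rf x Ux.
have [V' [e [u' [v' [oV' V'x hu' hv' guv]]]]] := rg x Ux.
exists (V `&` V'), (d + e)%N, (fun x => u x * v' x + v x * u' x),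
  (fun x => v x * v' x); split=> //.
- exact: openI.
- by apply: grD; apply: grM.
- exact: grM.
move=> y Uy [Vy V'y]; have [v0 ->] := fuv y Uy Vy.
have [v'0 ->] := guv y Uy V'y.
rewrite mulf_neq0//; split=> //.
by rewrite addf_div// [v y * u' y]mulrC.
Qed.

Fact zariski_regularM U f g : open U -> zariski_regular U f ->
  zariski_regular U g -> zariski_regular U (fun x => f x * g x).
Proof.
move=> _ rf rg x Ux; have [V [d [u [v [oV Vx hu hv fuv]]]]] := rf x Ux.
have [V' [e [u' [v' [oV' V'x hu' hv' guv]]]]] := rg x Ux.
exists (V `&` V'), (d + e)%N, (fun x => u x * u' x),
  (fun x => v x * v' x); split=> //; [exact: openI|exact: grM|exact: grM|].
move=> y Uy [Vy V'y]; have [v0 ->] := fuv y Uy Vy.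
have [v'0 ->] := guv y Uy V'y.
by rewrite mulf_neq0// mulf_div.
Qed.

Fact zariski_regular_open U f : open U -> zariski_regular U f ->
  open (U `&` [set x | f x != 0]).
Proof.
move=> oU rf; apply: openP => x [Ux /= fx].
have [V [d [u [v [oV Vx hu hv fuv]]]]] := rf x Ux.
exists (U `&` V `&` [set y | u y != 0]); split.
- by apply: openI; [exact: openI|apply: open_neq0; exists d].
- split=> //=; move: fx; have [_ ->] := fuv x Ux Vx.
  by apply: contra_neq => ->; rewrite mul0r.
- move=> y [[Uy Vy] /= uy]; split=> //=; have [vy ->] := fuv y Uy Vy.
  by rewrite mulf_neq0// invr_eq0.
Qed.

Fact zariski_regularV U f : open U -> zariski_regular U f ->
  zariski_regular (U `&` [set x | f x != 0]) (fun x => (f x)^-1).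
Proof.
move=> oU rf x [Ux fx]; have [V [d [u [v [oV Vx hu hv fuv]]]]] := rf x Ux.
exists V, d, v, u; split=> // y [Uy /= fy] Vy.
have [vy e] := fuv y Uy Vy; split.
  by apply: contra_neq fy; rewrite e => ->; rewrite mul0r.
by rewrite e invf_div.
Qed.

Definition zariski : fspace k :=
  Fspace zariski_regular_ext zariski_regular_cover zariski_regular_cst
    zariski_regularD zariski_regularM zariski_regular_open zariski_regularV.

End Zariski.

Section AffineSpace.
Variables (k : closedFieldType) (n : nat).

Definition affine_fun (_ : nat) : set ('rV[k]_n -> k) :=
  [set f | exists p : mpoly n k,
             f = fun x : 'rV[k]_n => meval (x 0) p].

Fact affine_fun_cst c : affine_fun 0 (fun=> c).
Proof.
by exists (mpolyC n c); apply/funext => x; rewrite mevalC.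
Qed.

Fact affine_funD d f g : affine_fun d f -> affine_fun d g ->
  affine_fun d (fun x => f x + g x).
Proof.
move=> [p ->] [q ->]; exists (p + q).
by apply/funext => x; rewrite mevalD.
Qed.

Fact affine_funM d e f g : affine_fun d f -> affine_fun e g ->
  affine_fun (d + e) (fun x => f x * g x).
Proof.
move=> [p ->] [q ->]; exists (p * q).
by apply/funext => x; rewrite mevalM.
Qed.

Definition affine_space : fspace k :=
  zariski (GradedFunctions affine_fun_cst affine_funD affine_funM).

End AffineSpace.

Section ProjectiveSpace.
Variables (k : closedFieldType) (n : nat).

(* The points of P^n are the lines of k^(n+1). *)
Definition proj_point : choiceType :=
  {L : {vspace 'rV[k]_n.+1} | \dim L == 1%N}.

Definition proj_eval (p : mpoly n.+1 k) (x : proj_point) : k :=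
  meval (vpick (val x) 0) p.

Definition homog (d : nat) (p : mpoly n.+1 k) : Prop :=
  p \is ishomog1 d mdeg.

Definition proj_fun (d : nat) : set (proj_point -> k) :=
  [set f | exists2 p, homog d p & f = proj_eval p].

Fact proj_fun_cst c : proj_fun 0 (fun=> c).
Proof.
exists (mpolyC n.+1 c).
  by rewrite /homog -alg_mpolyC rpredZ// dhomog1.
by apply/funext => x; rewrite /proj_eval mevalC.
Qed.

Fact proj_funD d f g : proj_fun d f -> proj_fun d g ->
  proj_fun d (fun x => f x + g x).
Proof.
move=> [p hp ->] [q hq ->]; exists (p + q); first by rewrite /homog rpredD.
by apply/funext => x; rewrite /proj_eval mevalD.
Qed.

Fact proj_funM d e f g : proj_fun d f -> proj_fun e g ->
  proj_fun (d + e) (fun x => f x * g x).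
Proof.
move=> [p hp ->] [q hq ->]; exists (p * q); first exact: dhomogM.
by apply/funext => x; rewrite /proj_eval mevalM.
Qed.

Definition projective_space : fspace k :=
  zariski (GradedFunctions proj_fun_cst proj_funD proj_funM).

Definition hyperplane (H : set projective_space) : Prop :=
  exists p, [/\ p != 0, homog 1 p & H = [set x | proj_eval p x = 0]].

End ProjectiveSpace.

Section Varieties.
Variable k : closedFieldType.

Definition affine_variety (X : fspace k) : Prop :=
  exists n (Z : set (affine_space k n)), closed Z /\ isomorphic X (induced Z).

Definition prevariety (X : fspace k) : Prop :=
  exists m (U : 'I_m -> set X),
    [/\ forall i, open (U i), \bigcup_i U i = setT &
        forall i, affine_variety (induced (U i))].

Definition separated (X : fspace k) : Prop :=
  forall (Y : fspace k) (phi psi : Y -> X), prevariety Y ->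
    is_morphism phi -> is_morphism psi -> closed [set y | phi y = psi y].

Definition is_variety (X : fspace k) : Prop := prevariety X /\ separated X.

Record variety := Variety {
  variety_space :> fspace k;
  varietyP : is_variety variety_space
}.

(* P, with projections p and q, is the product of X and Y over k. *)
Definition is_product (X Y P : variety) (p : P -> X) (q : P -> Y) : Prop :=
  [/\ is_morphism p, is_morphism q &
      forall (Z : variety) (f : Z -> X) (g : Z -> Y),
        is_morphism f -> is_morphism g ->
        exists! h : Z -> P, [/\ is_morphism h, p \o h = f & q \o h = g]].

Let affine_space_prevariety n : prevariety (affine_space k n).
Proof.
exists 1%N, (fun=> setT); split=> [_||_]; first exact: openT.
- by apply/seteqP; split=> // x _; exists ord0.
- by exists n, setT; split; [exact: closedT|exact: isomorphic_refl].
Qed.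

Let affine_space_separated n : separated (affine_space k n).
Proof.
move=> Y phi psi _ [cphi rphi] [cpsi rpsi].
pose c (i : 'I_n) (x : affine_space k n) : k := (x : 'rV[k]_n) 0 i.
have rc i : regular setT (c i).
  move=> x _; exists setT, 0%N, (c i), (fun=> 1); split=> //.
  - exact: openT.
  - exists (mpolyX k (mnm1 i)).
    by apply/funext => y; rewrite mevalXU.
  - exact: affine_fun_cst.
  - by move=> y _ _; rewrite oner_neq0 divr1.
have rd i : regular setT (fun y => c i (phi y) + (-1) * c i (psi y)).
  apply: regularD; first exact: openT.
    by apply: (rphi setT (c i)) => //; exact: openT.
  apply: regularM; first exact: openT.
    by apply: regular_cst; exact: openT.
  by apply: (rpsi setT (c i)) => //; exact: openT.
rewrite -openC.
suff -> : ~` [set y | phi y = psi y] =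
    \bigcup_i (setT `&` [set y | c i (phi y) + (-1) * c i (psi y) != 0]).
  by apply: bigcup_open => i _; apply: regular_open (rd i); exact: openT.
apply/seteqP; split=> [y /= ne|y [i _ [_ /= ne]] e].
  apply: contrapT => h; apply: ne; apply/rowP => i.
  apply: contrapT => /eqP ne; apply: h; exists i => //; split=> //=.
  by rewrite mulN1r subr_eq0.
by move: ne; rewrite e mulN1r subrr eqxx.
Qed.

Fact affine_space_variety n : is_variety (affine_space k n).
Proof. by []. Qed.

End Varieties.

Section Grothendieck.
Variable k : closedFieldType.

(* K_0(Var_k), presented as the commutative ring generated by the varieties   *)
(* with the relations K0_iso, K0_scissor, K0_prod and [Spec k] = 1: ring      *)
(* expressions in the classes of varieties, up to the congruence K0_eq.       *)
(* Varieties, whose underlying spaces contain powers of k, live in a larger   *)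
(* universe than the sorts of the mathcomp structures: the quotient cannot be *)
(* an instance of comPzRingType.                                              *)
Inductive K0_expr :=
| K0_class of variety k
| K0_zero
| K0_one
| K0_opp of K0_expr
| K0_add of K0_expr & K0_expr
| K0_mul of K0_expr & K0_expr.

Definition affine_class n : K0_expr :=
  K0_class (Variety (affine_space_variety k n)).

(* Locally closed subsets of a variety are varieties, so the hypotheses on    *)
(* Z and ~` Z in K0_scissor only serve to name the classes.                   *)
Inductive K0_eq : K0_expr -> K0_expr -> Prop :=
| K0_refl a : K0_eq a a
| K0_sym a b : K0_eq a b -> K0_eq b a
| K0_trans a b c : K0_eq a b -> K0_eq b c -> K0_eq a c
| K0_opp_congr a a' : K0_eq a a' -> K0_eq (K0_opp a) (K0_opp a')
| K0_add_congr a a' b b' : K0_eq a a' -> K0_eq b b' ->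
    K0_eq (K0_add a b) (K0_add a' b')
| K0_mul_congr a a' b b' : K0_eq a a' -> K0_eq b b' ->
    K0_eq (K0_mul a b) (K0_mul a' b')
| K0_addA a b c : K0_eq (K0_add a (K0_add b c)) (K0_add (K0_add a b) c)
| K0_addC a b : K0_eq (K0_add a b) (K0_add b a)
| K0_add0 a : K0_eq (K0_add K0_zero a) a
| K0_addN a : K0_eq (K0_add (K0_opp a) a) K0_zero
| K0_mulA a b c : K0_eq (K0_mul a (K0_mul b c)) (K0_mul (K0_mul a b) c)
| K0_mulC a b : K0_eq (K0_mul a b) (K0_mul b a)
| K0_mul1 a : K0_eq (K0_mul K0_one a) a
| K0_mulDl a b c :
    K0_eq (K0_mul (K0_add a b) c) (K0_add (K0_mul a c) (K0_mul b c))
| K0_iso (X Y : variety k) : isomorphic X Y ->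
    K0_eq (K0_class X) (K0_class Y)
| K0_scissor (X : variety k) (Z : set X)
    (hZ : is_variety (induced Z)) (hZC : is_variety (induced (~` Z))) :
    closed Z ->
    K0_eq (K0_class X) (K0_add (K0_class (Variety hZ)) (K0_class (Variety hZC)))
| K0_prod (X Y P : variety k) (p : P -> X) (q : P -> Y) : is_product p q ->
    K0_eq (K0_mul (K0_class X) (K0_class Y)) (K0_class P)
| K0_point : K0_eq (affine_class 0) K0_one.

Definition Lefschetz : K0_expr := affine_class 1.

(* [X] - 1 belongs to the ideal generated by the class of the affine line. *)
Definition L_rational (X : variety k) : Prop :=
  exists a : K0_expr,
    K0_eq (K0_add (K0_class X) (K0_opp K0_one)) (K0_mul Lefschetz a).

End Grothendieck.

(* Main.v *)
(** Since [l <= n], the hyperplanes have a common point, with a generator [v]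
    normalised by [v 0 i0 = 1]; so [X] is a closed cone with vertex [line v].
    The linear forms [w_j = x_j - v_j x_i0] cut out the vertex, and the closed
    sets [T_j], where [w_i = 0] for all [i < j], filter [X] down from
    [T_0 = X] to the vertex [T_(n+1)]. The chart [{a | w_j(a) = 1}] of [P^n]
    identifies the stratum [T_j \ T_(j+1)] with a closed subset of
    [k^(n+1)] that is invariant under translation by multiples of [v], hence
    with the product of the affine line and its slice [a_i0 = 0]. The scissor
    relations therefore give [[X] = 1 + L * sum_j [slice_j]].

    Separatedness of all the spaces involved comes from a property stronger
    than separatedness and inherited by arbitrary subsets: any two distinct
    points lie in an open set with a regular function taking distinct values
    at them. *)
Require Import Defs.
From mathcomp Require Import all_boot all_order all_algebra.
From mathcomp Require Import all_classical.
From mathcomp Require Import topology.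
From mathcomp Require Import -(notations) mpoly.

Set Implicit Arguments.
Unset Strict Implicit.
Unset Printing Implicit Defensive.

Import GRing.Theory.
Local Open Scope classical_set_scope.
Local Open Scope ring_scope.

(** * Regular functions: restriction, gluing and polynomial expressions *)

Section Regular.
Variables (k : closedFieldType) (X : fspace k).
Implicit Types (U V : set X) (f g : X -> k).

Lemma regular_sub U V f : open U -> open V -> V `<=` U ->
  regular U f -> regular V f.
Proof.
move=> oU oV VU rf.
(* As [V] lies in [U], the pair covers [U], and the sheaf axiom yields restriction. *)
have e : \bigcup_(W in [set U; V]) W = U.
  by rewrite bigcup_setU !bigcup_set1; apply/setUidPl.
have := @regular_cover _ X [set U; V] f; rewrite e => /(_ _).
by case=> [W [->|->]//|+ _] => /(_ rf); apply; right.
Qed.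

Lemma regular_local U f :
  (forall x, U x -> exists V, [/\ open V, V x, V `<=` U & regular V f]) ->
  regular U f.
Proof.
move=> h; pose C := [set V : set X | [/\ open V, V `<=` U & regular V f]].
have -> : U = \bigcup_(V in C) V.
  apply/seteqP; split=> [x /h[V [oV Vx VU rV]]|x [V [_ VU _] /VU//]].
  by exists V.
by apply/regular_cover => V [].
Qed.

Lemma open_local U :
  (forall x, U x -> exists V, [/\ open V, V x & V `<=` U]) -> open U.
Proof.
move=> h; rewrite openE => x /h[V [oV Vx VU]].
by apply: filterS VU _; exact: open_nbhs_nbhs.
Qed.

Lemma regularB U f g : open U -> regular U f -> regular U g ->
  regular U (fun x => f x - g x).
Proof.
move=> oU rf rg; apply: (@regular_ext _ _ U (fun x => f x + (-1) * g x)) => //.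
  by move=> x _; rewrite mulN1r.
by apply: regularD => //; apply: regularM => //; exact: regular_cst.
Qed.

Lemma regularX U f d : open U -> regular U f -> regular U (fun x => f x ^+ d).
Proof.
move=> oU rf; elim: d => [|d ih].
  by apply: regular_ext (regular_cst 1 oU) => // x _; rewrite expr0.
by apply: regular_ext (regularM oU rf ih) => // x _; rewrite exprS.
Qed.

Lemma regular_prod U (I : Type) (s : seq I) (F : I -> X -> k) : open U ->
  (forall i, regular U (F i)) -> regular U (fun x => \prod_(i <- s) F i x).
Proof.
move=> oU rF; elim: s => [|i s ih].
  by apply: regular_ext (regular_cst 1 oU) => // x _; rewrite big_nil.
by apply: regular_ext (regularM oU (rF i) ih) => // x _; rewrite big_cons.
Qed.

Lemma regular_sum U (I : Type) (s : seq I) (F : I -> X -> k) : open U ->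
  (forall i, regular U (F i)) -> regular U (fun x => \sum_(i <- s) F i x).
Proof.
move=> oU rF; elim: s => [|i s ih].
  by apply: regular_ext (regular_cst 0 oU) => // x _; rewrite big_nil.
by apply: regular_ext (regularD oU (rF i) ih) => // x _; rewrite big_cons.
Qed.

Lemma regular_meval n U (phi : X -> 'rV[k]_n) p : open U ->
  (forall i, regular U (fun x => phi x 0 i)) ->
  regular U (fun x => meval (phi x 0) p).
Proof.
move=> oU rphi; under eq_fun do rewrite mevalE.
apply: regular_sum => // m; apply: regularM => //; first exact: regular_cst.
by apply: regular_prod => // i; exact: regularX.
Qed.

End Regular.

(** * Morphisms and induced structures on subsets *)

Section Morphism.
Variable k : closedFieldType.
Implicit Types X Y Z : fspace k.

Lemma is_morphism_comp X Y Z (phi : X -> Y) (psi : Y -> Z) :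
  is_morphism phi -> is_morphism psi -> is_morphism (psi \o phi).
Proof.
move=> [cphi rphi] [cpsi rpsi]; split.
  by move=> x; apply: continuous_comp; [exact: cphi|exact: cpsi].
move=> V f oV rf; apply: (rphi (psi @^-1` V) (f \o psi)); last exact: rpsi.
by move/continuousP: cpsi; apply.
Qed.

Lemma is_morphism_cst X Y (y : Y) : is_morphism (fun _ : X => y).
Proof.
split; first by move=> x; exact: cvg_cst.
move=> V f oV rf; apply: regular_cst.
by move/continuousP: (@cst_continuous X Y y); apply.
Qed.

Lemma morphism_preimage_open X Y (phi : X -> Y) (V : set Y) :
  is_morphism phi -> open V -> open (phi @^-1` V).
Proof. by move=> [/continuousP cphi _]; exact: cphi. Qed.

Lemma isomorphic_trans Y X Z :
  isomorphic X Y -> isomorphic Y Z -> isomorphic X Z.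
Proof.
move=> [f [g [mf mg fK gK]]] [f' [g' [mf' mg' fK' gK']]].
exists (f' \o f), (g \o g'); split; try exact: is_morphism_comp.
- exact: can_comp.
- exact: can_comp.
Qed.

Lemma is_morphism_val X (A : set X) : is_morphism (val : induced A -> X).
Proof.
split; first by apply/continuousP => V oV; exists V.
move=> V f oV rf.
have h : induced_regular (val @^-1` V : set (set_type A)) (f \o val).
  by move=> x Vx; exists V, f.
exact: h.
Qed.

(** Universal property of the induced structure: a regular function on [induced B] is locally the
    restriction of one on [Y], and is pulled back from there. *)
Lemma is_morphism_induced X Y (B : set Y) (phi : X -> induced B) :
  is_morphism (val \o phi : X -> Y) -> is_morphism phi.
Proof.
move=> mphi.
have op (W : set (induced B)) : open W -> open (phi @^-1` W).
  by case=> V oV <-; exact: (morphism_preimage_open mphi oV).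
split; first by apply/continuousP.
move=> W f oW rf; apply: regular_local => x Wx.
have [V [g [oV Vx rg fg]]] := rf _ Wx.
have oV' := morphism_preimage_open mphi oV.
have oW' := op _ oW.
exists (phi @^-1` W `&` (val \o phi) @^-1` V); split => //.
- exact: openI.
- apply: (@regular_ext _ _ _ (g \o (val \o phi))); first exact: openI.
    by move=> y [Wy Vy] /=; rewrite fg.
  apply: regular_sub (mphi.2 V g oV rg) => //; first exact: openI.
Qed.

Definition lift_set (T U : Type) (B : set U) (phi : T -> U)
  (h : forall x, B (phi x)) : T -> set_type B :=
  fun x => exist _ (phi x) (mem_set (h x)).

Lemma is_morphism_lift X Y (B : set Y) (phi : X -> Y)
    (h : forall x, B (phi x)) : is_morphism phi ->
  is_morphism (lift_set h : X -> induced B).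
Proof. by move=> mphi; exact: is_morphism_induced. Qed.

(* On a subset, a morphism need only be the restriction of a total function. *)
Lemma isomorphic_induced X Y (A : set X) (B : set Y) (f : X -> Y) (g : Y -> X) :
  is_morphism (f \o val : induced A -> Y) ->
  is_morphism (g \o val : induced B -> X) ->
  (forall x, A x -> B (f x)) -> (forall y, B y -> A (g y)) ->
  (forall x, A x -> g (f x) = x) -> (forall y, B y -> f (g y) = y) ->
  isomorphic (induced A) (induced B).
Proof.
move=> mf mg fAB gBA fK gK.
have hf (x : induced A) : B ((f \o val) x) by apply: fAB; exact: set_valP.
have hg (y : induced B) : A ((g \o val) y) by apply: gBA; exact: set_valP.
exists (lift_set hf), (lift_set hg).
split; [exact: is_morphism_lift|exact: is_morphism_lift| |].
- by move=> x; apply: val_inj => /=; apply: fK; exact: set_valP.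
- by move=> y; apply: val_inj => /=; apply: gK; exact: set_valP.
Qed.

Lemma induced_induced X (B : set X) (A : set (induced B)) :
  isomorphic (induced A) (induced (val @` A : set X)).
Proof.
have hB (y : induced (val @` A : set X)) : B (val y).
  by have [x _ <-] := set_valP y; exact: set_valP.
have hA (y : induced (val @` A : set X)) : A (lift_set hB y).
  have [x Ax xy] := set_valP y.
  suff -> : lift_set hB y = x by [].
  by apply: val_inj; exact: esym xy.
have hv (x : induced A) : (val @` A) (val (val x)).
  by exists (val x) => //; exact: set_valP.
exists (lift_set hv), (lift_set hA); split.
- apply: is_morphism_lift.
  exact: (is_morphism_comp (@is_morphism_val _ A) (@is_morphism_val _ B)).
- by do 2!apply: is_morphism_lift; exact: is_morphism_val.
- by move=> x; do 2!apply: val_inj.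
- by move=> y; apply: val_inj.
Qed.

Lemma isomorphic_restrict X Y (phi : X -> Y) (psi : Y -> X) (U : set Y) :
  is_morphism phi -> is_morphism psi -> cancel phi psi -> cancel psi phi ->
  isomorphic (induced (phi @^-1` U)) (induced U).
Proof.
move=> mphi mpsi phiK psiK; apply: (@isomorphic_induced _ _ _ _ phi psi) => //.
- exact: (is_morphism_comp (@is_morphism_val _ _) mphi).
- exact: (is_morphism_comp (@is_morphism_val _ _) mpsi).
- by move=> y Uy; rewrite /= psiK.
Qed.

Lemma isomorphic_induced_setT X : isomorphic (induced (@setT X)) X.
Proof.
have h (x : X) : @setT X x by [].
exists val, (lift_set h); split=> //.
- exact: is_morphism_val.
- by apply: is_morphism_lift; exact: is_morphism_id.
- by move=> x; apply: val_inj.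
Qed.

End Morphism.

(** * Separatedness, and transport of affine covers *)

Section Variety.
Variable k : closedFieldType.
Implicit Types X Y : fspace k.

(** The function lives on an open [U] containing both points, since global regular functions on a
    projective space are constant. *)
Definition point_separating X := forall x y : X, x <> y ->
  exists (U : set X) (f : X -> k),
    [/\ open U, U x, U y, regular U f & f x != f y].

(** Near a point where [phi] and [psi] disagree, the pullbacks of a separating function have a
    regular difference; the open locus where it is non-zero avoids the equaliser. *)
Lemma point_separating_separated X : point_separating X -> Defs.separated X.
Proof.
move=> sX Y phi psi _ mphi mpsi; rewrite -openC; apply: open_local => y nyy.
have [U [f [oU Ux Uy rf fxy]]] := sX _ _ nyy.
have oa := morphism_preimage_open mphi oU.
have ob := morphism_preimage_open mpsi oU.
have oab := openI oa ob.
have ra := regular_sub oa oab (@subIsetl _ _ _) (mphi.2 _ _ oU rf).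
have rb := regular_sub ob oab (@subIsetr _ _ _) (mpsi.2 _ _ oU rf).
eexists; split; first exact: regular_open oab (regularB oab ra rb).
- by split=> //=; rewrite subr_eq0.
- by move=> z [_ /=] + e; rewrite e subrr eqxx.
Qed.

Lemma point_separating_induced X (A : set X) :
  point_separating X -> point_separating (induced A).
Proof.
move=> sX x y xy.
have /sX[U [f [oU Ux Uy rf fxy]]] : val x <> val y by move/val_inj.
have [_ rv] := @is_morphism_val _ X A.
exists (val @^-1` U), (f \o val); split=> //.
- exact: morphism_preimage_open (@is_morphism_val _ _ _) oU.
- exact: rv.
Qed.

Lemma isomorphic_prevariety X Y :
  isomorphic X Y -> prevariety Y -> prevariety X.
Proof.
move=> [f [g [mf mg fK gK]]] [m [U [oU cU aU]]].
exists m, (fun i => f @^-1` U i); split.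
- by move=> i; exact: morphism_preimage_open.
- by rewrite -preimage_bigcup cU.
- move=> i; have [n [Z [cZ iZ]]] := aU i.
  exists n, Z; split=> //; apply: isomorphic_trans iZ.
  exact: (isomorphic_restrict _ mf mg).
Qed.

Lemma affine_prevariety X : affine_variety X -> prevariety X.
Proof.
move=> [n [Z [cZ iZ]]]; exists 1%N, (fun=> setT); split=> [_||_].
- exact: openT.
- by apply/seteqP; split=> // x _; exists ord0.
- exists n, Z; split=> //; apply: isomorphic_trans iZ.
  exact: isomorphic_induced_setT.
Qed.

End Variety.

(** * Zariski closed sets and morphisms into a Zariski space *)

Section Zariski.
Variables (k : closedFieldType) (G : gradedFunctions k).

Lemma zariski_closed_zeros (S : set (zariski_point G -> k)) :
  (forall f, S f -> homogeneous f) ->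
  closed ([set x | forall f, S f -> f x = 0] : set (zariski G)).
Proof.
move=> hS; rewrite -openC.
have h : zariski_open (~` [set x | forall f, S f -> f x = 0]).
  by exists S => //; rewrite setCK.
exact: h.
Qed.

Lemma zariski_closedP (Z : set (zariski G)) : closed Z ->
  exists2 S : set (zariski_point G -> k),
    (forall f, S f -> homogeneous f) & Z = [set x | forall f, S f -> f x = 0].
Proof. by rewrite -openC => -[S hS]; rewrite setCK => ->; exists S. Qed.

Lemma zariski_quotient_regular (U : set (zariski G)) d u v :
  gr d u -> gr d v -> (forall x, U x -> v x != 0) ->
  regular U (fun x => u x / v x).
Proof.
move=> hu hv v0.
have h : zariski_regular U (fun x => u x / v x).
  move=> x Ux; exists setT, d, u, v; split=> //; first exact: openT.
  by move=> y Uy _; split=> //; exact: v0.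
exact: h.
Qed.

(* The factors [c d] absorb the choice of a generator of a line in the values *)
(* of the homogeneous polynomials of degree [d] on the projective space.      *)
Lemma zariski_is_morphism (X : fspace k) (phi : X -> zariski G)
    (c : nat -> X -> k) : (forall d x, c d x != 0) ->
  (forall d u, gr d u -> regular setT (fun x => c d x * u (phi x))) ->
  is_morphism phi.
Proof.
move=> c0 ru.
have openu d u : gr d u -> open [set x | u (phi x) != 0].
  move=> hu; have := regular_open openT (ru d u hu); rewrite setTI.
  congr open; apply/funext => x /=.
  by rewrite mulf_eq0 negb_or c0.
have op (V : set (zariski G)) : open V -> open (phi @^-1` V).
  move=> oV; have : closed (~` V) by rewrite closedC.
  move=> /zariski_closedP[S hS eV]; apply: open_local => x Vx.
  have : ~ (~` V) (phi x) by [].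
  rewrite eV => /existsNP[f /not_implyP[Sf /eqP fx]].
  have [d hf] := hS f Sf.
  exists [set x | f (phi x) != 0]; split=> //; first exact: openu hf.
  move=> y /= fy; apply: contrapT => nVy.
  have : (~` V) (phi y) by [].
  by rewrite eV => /(_ f Sf) e; rewrite e eqxx in fy.
split; first by apply/continuousP.
move=> V f oV rf; apply: regular_local => x Vx.
have rf' : zariski_regular V f by [].
have [W [d [u [v [oW Wx hu hv fuv]]]]] := rf' _ Vx.
have oVW : open (phi @^-1` (V `&` W)) by apply: op; exact: openI.
exists (phi @^-1` (V `&` W)); split=> //; first by move=> y [].
have vn y : (V `&` W) (phi y) -> v (phi y) != 0.
  by move=> [Vy Wy]; have [] := fuv _ Vy Wy.
have r1 := regularV openT (ru d v hv).
have r2 : regular (phi @^-1` (V `&` W)) (fun x => (c d x * v (phi x))^-1).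
  apply: regular_sub r1 => //.
    by apply: regular_open (ru d v hv); exact: openT.
  by move=> y Vy; split=> //=; rewrite mulf_neq0// vn.
have r3 := regular_sub openT oVW (@subsetT _ _) (ru d u hu).
(* In the quotient of the two pullbacks the factors [c d] cancel. *)
apply: (regular_ext oVW) (regularM oVW r3 r2) => y [Vy Wy] /=.
have [v0 ->] := fuv _ Vy Wy.
by rewrite -mulf_div divff// mul1r.
Qed.

End Zariski.

(** * Affine space *)

Section Affine.
Variables (k : closedFieldType) (n : nat).

Local Notation affine_graded := (GradedFunctions (@affine_fun_cst k n)
  (@affine_funD k n) (@affine_funM k n)).

Lemma affine_is_morphism (X : fspace k) (phi : X -> affine_space k n) :
  (forall i, regular setT (fun x => (phi x : 'rV[k]_n) 0 i)) -> is_morphism phi.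
Proof.
move=> rphi.
apply: (@zariski_is_morphism _ _ X phi (fun _ _ => 1)).
  by move=> _ _; exact: oner_neq0.
move=> d _ [p ->]; apply: (@regular_ext _ _ setT (fun x => meval (phi x 0) p)).
- exact: openT.
- by move=> x _; rewrite mul1r.
- by apply: regular_meval => //; exact: openT.
Qed.

Lemma affine_regular_meval (p : mpoly n k) :
  regular (@setT (affine_space k n)) (fun a => meval ((a : 'rV[k]_n) 0) p).
Proof.
have h1 : @gr _ affine_graded 0%N (fun _ : 'rV[k]_n => 1).
  exact: affine_fun_cst.
have hp : @gr _ affine_graded 0%N (fun a : 'rV[k]_n => meval (a 0) p).
  by exists p.
apply: (@regular_ext _ (affine_space k n) setT
  (fun a => meval ((a : 'rV[k]_n) 0) p / 1)); first exact: openT.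
  by move=> x _; rewrite divr1.
apply: (zariski_quotient_regular hp h1) => x _; exact: oner_neq0.
Qed.

Lemma affine_regular_coord i :
  regular (@setT (affine_space k n)) (fun a => (a : 'rV[k]_n) 0 i).
Proof.
apply: regular_ext (affine_regular_meval (mpolyX k (mnm1 i))).
  exact: openT.
by move=> a _; rewrite mevalXU.
Qed.

Lemma affine_closed_zeros (P : set (mpoly n k)) :
  closed ([set a | forall p, P p -> meval ((a : 'rV[k]_n) 0) p = 0]
    : set (affine_space k n)).
Proof.
pose S := [set f | exists2 p, P p & f = fun a : 'rV[k]_n => meval (a 0) p].
have -> : [set a : affine_space k n |
      forall p, P p -> meval ((a : 'rV[k]_n) 0) p = 0] =
    [set x | forall f, S f -> f x = 0].
  apply/seteqP; split=> a /= h; first by move=> _ [p Pp ->]; exact: h.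
  by move=> p Pp; apply: (h (fun a : 'rV[k]_n => meval (a 0) p)); exists p.
by apply: zariski_closed_zeros => _ [p _ ->]; exists 0%N; exists p.
Qed.

Lemma affine_point_separating : point_separating (affine_space k n).
Proof.
move=> x y xy.
have [i xyi] : exists i, (x : 'rV[k]_n) 0 i != (y : 'rV[k]_n) 0 i.
  apply: contrapT => h; apply: xy; apply/rowP => i; apply/eqP.
  by apply: contra_notT h => ?; exists i.
exists setT, (fun a : affine_space k n => (a : 'rV[k]_n) 0 i).
by split=> //; [exact: openT|exact: affine_regular_coord].
Qed.

Lemma affine_closed_variety (Z : set (affine_space k n)) :
  closed Z -> is_variety (induced Z).
Proof.
move=> cZ; split.
  by apply: affine_prevariety; exists n, Z; split=> //; exact: isomorphic_refl.
by apply: point_separating_separated; apply: point_separating_induced;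
  exact: affine_point_separating.
Qed.

End Affine.

(** * Projective space in homogeneous coordinates *)

Section Projective.
Variables (k : closedFieldType) (n : nat).
Local Notation vec := 'rV[k]_n.+1.
Local Notation P := (projective_space k n).
Local Notation projective_graded := (GradedFunctions (@proj_fun_cst k n)
  (@proj_funD k n) (@proj_funM k n)).

Lemma meval_homogZ d (p : mpoly n.+1 k) (c : k) (a : vec) : homog d p ->
  meval ((c *: a) 0) p = c ^+ d * meval (a 0) p.
Proof.
move=> /dhomogP hp; rewrite !mevalE mulr_sumr !big_seq.
apply: eq_bigr => m /hp <-; rewrite mulrCA; congr (_ * _).
under eq_bigr do rewrite mxE exprMn.
by rewrite big_split/= prodrXr mdegE.
Qed.

(** A monomial of degree 1 is a single variable, so [p] is a linear combination of coordinates. *)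
Lemma meval_linear_form (p : mpoly n.+1 k) : homog 1 p ->
  linear_for *%R (fun a : vec => meval (a 0) p).
Proof.
move=> /dhomogP hp c a b; rewrite !mevalE mulr_sumr -big_split !big_seq.
apply: eq_bigr => m /hp /eqP/mdeg1P[i /eqP ->] /=.
have e (v : vec) : \prod_j v 0 j ^+ (mnm1 i : multinom n.+1) j = v 0 i.
  by rewrite -mevalX mevalXU.
by rewrite !e !mxE mulrDr mulrCA.
Qed.

Lemma dim_line (a : vec) : a != 0 -> \dim <[a]>%VS == 1%N.
Proof. by rewrite dim_vline => ->. Qed.

Lemma const_mx1_neq0 : (const_mx 1 : vec) != 0.
Proof.
by apply/eqP => /rowP/(_ 0); rewrite !mxE => /eqP; rewrite oner_eq0.
Qed.

(* [line 0] is a junk value. *)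
Definition line (a : vec) : P :=
  insubd (exist _ <[const_mx 1]>%VS (dim_line const_mx1_neq0) : proj_point k n)
    <[a]>%VS.

Definition rep (x : P) : vec := vpick (val (x : proj_point k n)).

Lemma proj_evalE p (x : P) : proj_eval p x = meval (rep x 0) p.
Proof. by []. Qed.

Lemma val_line (a : vec) : a != 0 -> val (line a : proj_point k n) = <[a]>%VS.
Proof. by move=> a0; rewrite val_insubd dim_line. Qed.

Lemma rep_neq0 (x : P) : rep x != 0.
Proof.
have /eqP := valP (x : proj_point k n); rewrite /rep vpick0 => d.
by apply/eqP => e; rewrite e dimv0 in d.
Qed.

Lemma line_rep (x : P) : line (rep x) = x.
Proof.
apply: (@val_inj _ _ (proj_point k n)); rewrite val_line ?rep_neq0//.
apply/eqP; rewrite eqEdim dim_vline rep_neq0 (eqP (valP (x : proj_point k n))).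
by rewrite andbT -memvE memv_pick.
Qed.

Lemma rep_line (a : vec) : a != 0 ->
  exists2 c, c != 0 & rep (line a) = c *: a.
Proof.
move=> a0; have := rep_neq0 (line a).
have : rep (line a) \in <[a]>%VS by rewrite -val_line// memv_pick.
by move=> /vlineP[c ->]; rewrite scaler_eq0 negb_or => /andP[c0 _]; exists c.
Qed.

Lemma lineZ c (a : vec) : c != 0 -> line (c *: a) = line a.
Proof.
move=> c0; have [->|a0] := eqVneq a 0; first by rewrite scaler0.
have ca0 : c *: a != 0 by rewrite scaler_eq0 negb_or c0.
apply: (@val_inj _ _ (proj_point k n)); rewrite !val_line//.
apply/eqP; rewrite eqEdim !dim_vline a0 ca0 andbT -memvE.
by apply/vlineP; exists c.
Qed.

Lemma linear_form_eq1_neq0 p (a : vec) : homog 1 p -> meval (a 0) p = 1 ->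
  a != 0.
Proof.
move=> hp; apply: contra_eq_neq => ->.
have <- : 0 *: (0 : vec) = 0 by rewrite scaler0.
by rewrite (meval_homogZ _ _ hp) mul0r eq_sym oner_neq0.
Qed.

Lemma proj_eval_line_eq0 d p (a : vec) : homog d p -> a != 0 ->
  (proj_eval p (line a) == 0) = (meval (a 0) p == 0).
Proof.
move=> hp a0; rewrite proj_evalE; have [c c0 ->] := rep_line a0.
by rewrite (meval_homogZ _ _ hp) mulf_eq0 expf_eq0 (negPf c0) andbF.
Qed.

Lemma proj_is_morphism (X : fspace k) (phi : X -> vec) :
  (forall x, phi x != 0) -> (forall i, regular setT (fun x => phi x 0 i)) ->
  is_morphism (line \o phi : X -> P).
Proof.
move=> phi0 rphi.
have /choice[c hc] x : exists c, c != 0 /\ rep (line (phi x)) = c *: phi x.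
  by have [c c0 e] := rep_line (phi0 x); exists c.
(* Nothing is known about how [c] depends on [x]; dividing by [c x ^+ d] turns the value of a form
   at the chosen generator into its value at [phi x]. *)
apply: (@zariski_is_morphism _ _ X (line \o phi) (fun d x => (c x ^+ d)^-1)).
  by move=> d x; rewrite invr_eq0 expf_neq0//; have [] := hc x.
move=> d _ [p hp ->].
apply: (@regular_ext _ _ setT (fun x => meval (phi x 0) p)).
- exact: openT.
- move=> x _; have [c0 e] := hc x.
  by rewrite /= proj_evalE e (meval_homogZ _ _ hp) mulKf// expf_neq0.
- by apply: regular_meval => //; exact: openT.
Qed.

Lemma proj_regular_quotient (U : set P) (d : nat) p q :
  homog d p -> homog d q -> (forall x, U x -> proj_eval q x != 0) ->
  regular U (fun x => proj_eval p x / proj_eval q x).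
Proof.
move=> hp hq q0.
have h1 : @gr _ projective_graded d (proj_eval p) by exists p.
have h2 : @gr _ projective_graded d (proj_eval q) by exists q.
exact: (zariski_quotient_regular h1 h2).
Qed.

Lemma proj_closed_zero d p : homog d p ->
  closed ([set x | proj_eval p x = 0] : set P).
Proof.
move=> hp.
have -> : [set x : P | proj_eval p x = 0] =
    [set x | forall f, [set proj_eval p] f -> f x = 0].
  by apply/seteqP; split=> x /= h; [move=> _ ->|exact: h].
by apply: zariski_closed_zeros => _ ->; exists d; exists p.
Qed.

Lemma proj_open_neq0 d p : homog d p ->
  open ([set x | proj_eval p x != 0] : set P).
Proof.
move=> hp; have -> : [set x : P | proj_eval p x != 0] =
    ~` [set x | proj_eval p x = 0] by apply/seteqP; split=> x /= /eqP.
by rewrite openC; exact: proj_closed_zero hp.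
Qed.

Lemma homogX i : homog 1 (mpolyX k (mnm1 i) : mpoly n.+1 k).
Proof. by rewrite /homog dhomogX; apply/eqP; exact: mdeg1. Qed.

Lemma proj_evalX i (x : P) : proj_eval (mpolyX k (mnm1 i)) x = rep x 0 i.
Proof. by rewrite proj_evalE mevalXU. Qed.

(** Given a linear form [w] vanishing at neither point, the ratios of the coordinates to [w] are
    regular where [w] is non-zero and determine the line. *)
Lemma proj_point_separating : point_separating P.
Proof.
move=> x y xy.
have nz (v : P) : exists i, rep v 0 i != 0.
  apply: contrapT => h; have /eqP := rep_neq0 v; apply; apply/rowP => i.
  by rewrite mxE; apply/eqP; apply: contra_notT h => ?; exists i.
have [w [hw wx wy]] :
    exists w, [/\ homog 1 w, proj_eval w x != 0 & proj_eval w y != 0].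
  have [i xi] := nz x; have [j yj] := nz y.
  have [xj|xj] := eqVneq (rep x 0 j) 0; last first.
    exists (mpolyX k (mnm1 j)); rewrite !proj_evalX.
    by split=> //; exact: homogX.
  have [yi|yi] := eqVneq (rep y 0 i) 0; last first.
    exists (mpolyX k (mnm1 i)); rewrite !proj_evalX.
    by split=> //; exact: homogX.
  (* Coordinate [j] vanishes at [x] and coordinate [i] at [y], so their sum is non-zero at both. *)
  exists (mpolyX k (mnm1 i) + mpolyX k (mnm1 j)).
  rewrite !proj_evalE !mevalD !mevalXU xj yi addr0 add0r; split=> //.
  by apply: rpredD; exact: homogX.
have [i xyi] : exists i, proj_eval (mpolyX k (mnm1 i)) x / proj_eval w x !=
    proj_eval (mpolyX k (mnm1 i)) y / proj_eval w y.
  (* If all ratios agreed, the generators rescaled to give [w] the value 1 would coincide. *)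
  apply: contrapT => h; apply: xy; rewrite -(line_rep x) -(line_rep y).
  rewrite -(@lineZ (proj_eval w x)^-1) ?invr_eq0//.
  rewrite -[in RHS](@lineZ (proj_eval w y)^-1) ?invr_eq0//.
  congr line; apply/rowP => i; apply/eqP; rewrite !mxE.
  apply: contra_notT h => h; exists i; rewrite !proj_evalX.
  by rewrite ![_ / _]mulrC.
exists [set z | proj_eval w z != 0],
  (fun z => proj_eval (mpolyX k (mnm1 i)) z / proj_eval w z); split=> //.
- exact: proj_open_neq0 hw.
- exact: (proj_regular_quotient (homogX i) hw).
Qed.

End Projective.

(** * Scissor relations inside an ambient space *)

Section Subsets.
Variable k : closedFieldType.

Lemma induced_preimage (X : fspace k) (A B : set X) :
  isomorphic (induced (val @^-1` B : set (induced A))) (induced (A `&` B)).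
Proof.
suff <- : (val : induced A -> X) @` (val @^-1` B) = A `&` B.
  exact: induced_induced.
apply/seteqP; split=> [_ [x Bx <-]|x [Ax Bx]].
  by split=> //; exact: set_valP.
by exists (exist _ x (mem_set Ax)).
Qed.

(** [K0_scissor] cuts [induced A] into subspaces of a subspace; these are isomorphic to subspaces of
    [X] itself. *)
Lemma K0_scissor_subset (X : fspace k) (A B : set X)
    (hA : is_variety (induced A))
    (hB : is_variety (induced (A `&` B)))
    (hBC : is_variety (induced (A `&` ~` B))) :
  point_separating X -> closed B ->
  K0_eq (K0_class (Variety hA))
    (K0_add (K0_class (Variety hB)) (K0_class (Variety hBC))).
Proof.
move=> sX cB; pose Z : set (induced A) := val @^-1` B.
have iB : isomorphic (induced Z) (induced (A `&` B)) by exact: induced_preimage.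
have iBC : isomorphic (induced (~` Z)) (induced (A `&` ~` B)).
  exact: (@induced_preimage X A (~` B)).
have variety_in (W : set (induced A)) (Y : fspace k) :
    isomorphic (induced W) Y -> is_variety Y -> is_variety (induced W).
  move=> iW [pY _]; split; first exact: isomorphic_prevariety iW pY.
  by apply: point_separating_separated; do 2!apply: point_separating_induced.
have cZ : closed Z.
  rewrite -openC.
  apply: (morphism_preimage_open (@is_morphism_val k _ A) (V := ~` B)).
  by rewrite openC.
pose S := @K0_scissor k (Variety hA) Z (variety_in _ _ iB hB)
  (variety_in _ _ iBC hBC) cZ.
by apply: K0_trans S _; apply: K0_add_congr; apply: K0_iso.
Qed.

End Subsets.

(** * Translation-invariant sets as products with the affine line *)

Section Cylinder.
Variables (k : closedFieldType) (m : nat) (v : 'rV[k]_m) (i0 : 'I_m).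
Hypothesis v1 : v 0 i0 = 1.
Variable Z : set (affine_space k m).
Hypothesis Zv : forall (a : 'rV[k]_m) c, Z a -> Z (a + c *: v).
Local Notation Z0 := (Z `&` [set a | (a : 'rV[k]_m) 0 i0 = 0]).

Lemma affine_regular_val (A : set (affine_space k m)) i :
  regular (@setT (induced A)) (fun a => (val a : 'rV[k]_m) 0 i).
Proof.
exact: ((@is_morphism_val k _ A).2 _ _ openT (affine_regular_coord i)).
Qed.

(** Since [v 0 i0 = 1], each [a] in [Z] is uniquely [b + c *: v] with [b] in the slice, namely with
    [c = a 0 i0]. This makes [Z] the product of the line and the slice. *)
Lemma K0_cylinder (hZ : is_variety (induced Z))
    (hZ0 : is_variety (induced Z0)) :
  K0_eq (K0_class (Variety hZ))
    (K0_mul (Lefschetz k) (K0_class (Variety hZ0))).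
Proof.
pose p (a : induced Z) : affine_space k 1 :=
  const_mx ((val a : 'rV[k]_m) 0 i0).
pose q' (a : induced Z) : affine_space k m :=
  (val a : 'rV[k]_m) - (val a : 'rV[k]_m) 0 i0 *: v.
have q'P a : Z0 (q' a).
  split; first by rewrite /q' -scaleNr; apply: Zv; exact: set_valP.
  by rewrite /= !mxE v1 mulr1 subrr.
pose q : induced Z -> induced Z0 := lift_set q'P.
apply: K0_sym.
apply: (@K0_prod k (Variety (affine_space_variety k 1)) (Variety hZ0)
  (Variety hZ) p q); split.
- apply: affine_is_morphism => i.
  apply: regular_ext (affine_regular_val i0); first exact: openT.
  by move=> a _; rewrite mxE.
- apply: is_morphism_lift; apply: affine_is_morphism => i.
  apply: (@regular_ext _ _ _ (fun a : induced Z => (val a : 'rV[k]_m) 0 i -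
      (val a : 'rV[k]_m) 0 i0 * v 0 i)); first exact: openT.
    by move=> a _; rewrite !mxE.
  apply: regularB; [exact: openT|exact: affine_regular_val|].
  apply: regularM; [exact: openT|exact: affine_regular_val|].
  by apply: regular_cst; exact: openT.
move=> W f g mf mg.
(* The mediating map recombines the slice component with the multiple of [v]. *)
pose h' (w : W) : affine_space k m :=
  (val (g w : induced Z0) : 'rV[k]_m) + (f w : 'rV[k]_1) 0 0 *: v.
have h'P w : Z (h' w).
  by apply: Zv; have [] := set_valP (g w : induced Z0).
have g0 w : (val (g w : induced Z0) : 'rV[k]_m) 0 i0 = 0.
  by have [] := set_valP (g w : induced Z0).
have h'0 w : (h' w : 'rV[k]_m) 0 i0 = (f w : 'rV[k]_1) 0 0.
  by rewrite !mxE g0 v1 mulr1 add0r.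
pose h : W -> induced Z := lift_set h'P.
exists h; split; first split.
- apply: is_morphism_lift; apply: affine_is_morphism => i.
  apply: (@regular_ext _ _ _ (fun w : W =>
      (val (g w : induced Z0) : 'rV[k]_m) 0 i + (f w : 'rV[k]_1) 0 0 * v 0 i)).
  + exact: openT.
  + by move=> w _; rewrite !mxE.
  apply: regularD; first exact: openT.
    exact: (mg.2 setT _ openT (affine_regular_val (A := Z0) i)).
  apply: regularM; first exact: openT.
    exact: (mf.2 setT _ openT (affine_regular_coord 0)).
  by apply: regular_cst; exact: openT.
- by apply/funext => w; apply/rowP => i; rewrite (ord1 i) [LHS]mxE; exact: h'0.
- apply/funext => w; apply: val_inj; rewrite /= /q' /=.
  by rewrite h'0 addrK.
(* Uniqueness: a point of [Z] is recovered from its two projections. *)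
move=> h2 [_ pf qg]; apply/funext => w; apply: val_inj => /=.
by rewrite /h' -pf -qg /= mxE subrK.
Qed.

End Cylinder.

(** * Affine charts of closed subsets of projective space *)

Section Chart.
Variables (k : closedFieldType) (n : nat).
Local Notation vec := 'rV[k]_n.+1.
Local Notation P := (projective_space k n).
Variables (T : set P) (w : mpoly n.+1 k).
Hypotheses (cT : closed T) (hw : homog 1 w).

(** A line on which [w] is non-zero is represented by its generator with [w] equal to 1. Keeping all
    [n.+1] coordinates allows any linear form [w] and keeps translations of vectors visible. *)
Definition chart : set (affine_space k n.+1) :=
  [set a | meval ((a : vec) 0) w = 1 /\ T (line a)].

Lemma chart_neq0 (a : vec) : chart a -> a != 0.
Proof. by move=> [aw _]; exact: linear_form_eq1_neq0 hw aw. Qed.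

Lemma chart_closed : closed chart.
Proof.
have [S hS eT] := zariski_closedP cT.
(* [S] consists of functions of lines; the corresponding equations on vectors are the homogeneous
   [p] with [proj_eval p] in [S]. *)
have -> : chart = [set a | forall p,
    [set p | p = w - 1 \/ S (proj_eval p) /\ exists d, homog d p] p ->
    meval ((a : vec) 0) p = 0]; last exact: affine_closed_zeros.
apply/seteqP; split=> [a aZ p /= [->|[Sp [d hp]]]|a h].
- by case: aZ => aw _; rewrite mevalB meval1 aw subrr.
- have a0 := chart_neq0 aZ; case: aZ => _; rewrite eT => /(_ _ Sp) /eqP.
  by rewrite (proj_eval_line_eq0 hp a0) => /eqP.
- have aw : meval ((a : vec) 0) w = 1.
    apply/eqP; rewrite -subr_eq0 -(meval1 ((a : vec) 0)) -mevalB; apply/eqP.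
    by apply: h; left.
  split=> //; rewrite eT => f Sf.
  have [d [p hp e]] := hS f Sf; rewrite e in Sf *.
  have a0 := linear_form_eq1_neq0 hw aw.
  apply/eqP; rewrite (proj_eval_line_eq0 hp a0); apply/eqP.
  by apply: h; right; split=> //; exists d.
Qed.

Lemma chart_isomorphic :
  isomorphic (induced (T `&` [set x | proj_eval w x != 0])) (induced chart).
Proof.
(* After rescaling, the coordinates are quotients of linear forms, independent of the chosen
   generator. *)
pose f (x : P) : affine_space k n.+1 := (proj_eval w x)^-1 *: rep x.
apply: (@isomorphic_induced _ _ _ _ _ f (@line k n)).
- apply: affine_is_morphism => i.
  set A := T `&` _.
  pose u x := proj_eval (mpolyX k (mnm1 i)) x / proj_eval w x.
  have ru : regular [set x : P | proj_eval w x != 0] u.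
    exact: (proj_regular_quotient (homogX k i) hw).
  have ow := proj_open_neq0 hw.
  have := (@is_morphism_val k _ A).2 _ _ ow ru.
  (* As [w] has no zero on [A], the open set on which [u] is regular pulls back to the whole
     subspace. *)
  have -> : val @^-1` [set x : P | proj_eval w x != 0] = @setT (induced A).
    by apply/seteqP; split=> // x _; have [] := set_valP x.
  apply: regular_ext; first exact: openT.
  by move=> x _; rewrite /= /u /f proj_evalX mxE mulrC.
- apply: (@proj_is_morphism k n (induced chart) val).
    by move=> a; apply: chart_neq0; exact: set_valP.
  by move=> i; exact: affine_regular_val.
- move=> x [Tx wx]; split; last by rewrite lineZ ?invr_eq0// line_rep.
  by rewrite /f (meval_homogZ _ _ hw) expr1 -proj_evalE mulVf.
- move=> a aZ; have a0 := chart_neq0 aZ; case: aZ => aw Ta; split=> //=.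
  by rewrite (proj_eval_line_eq0 hw a0) aw oner_neq0.
- by move=> x [Tx wx]; rewrite lineZ ?invr_eq0// line_rep.
- move=> a aZ; have a0 := chart_neq0 aZ; case: aZ => aw Ta.
  rewrite /f proj_evalE; have [c c0 ->] := rep_line a0.
  by rewrite (meval_homogZ _ _ hw) aw expr1 mulr1 scalerA mulVf// scale1r.
Qed.

Lemma chart_affine_variety :
  affine_variety (induced (T `&` [set x | proj_eval w x != 0])).
Proof.
by exists n.+1, chart; split; [exact: chart_closed|exact: chart_isomorphic].
Qed.

End Chart.

(** * Closed subsets and points of projective space *)

Section ProjectiveVariety.
Variables (k : closedFieldType) (n : nat).
Local Notation P := (projective_space k n).

Lemma proj_subset_separated (A : set P) : Defs.separated (induced A).
Proof.
apply: point_separating_separated; apply: point_separating_induced.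
exact: proj_point_separating.
Qed.

(** The charts of the coordinate forms cover [T], because a generator of a line has a non-zero
    coordinate. *)
Lemma proj_closed_variety (T : set P) : closed T -> is_variety (induced T).
Proof.
move=> cT; split; last exact: proj_subset_separated.
pose V (i : 'I_n.+1) : set P :=
  [set x | proj_eval (mpolyX k (mnm1 i)) x != 0].
exists n.+1, (fun i => val @^-1` V i); split=> [i||i].
- apply: (morphism_preimage_open (@is_morphism_val k _ T)).
  exact: proj_open_neq0 (homogX k i).
- apply/seteqP; split=> // x _.
  apply: contrapT => h; have /eqP := rep_neq0 (val x : P); apply.
  apply/rowP => i; rewrite mxE; apply/eqP; apply: contra_notT h => xi.
  by exists i => //; rewrite /V /= proj_evalX.
- have [m [Z [cZ iZ]]] := chart_affine_variety cT (homogX k i).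
  exists m, Z; split=> //; apply: isomorphic_trans iZ.
  exact: induced_preimage.
Qed.

Lemma K0_proj_point (x : P) (hx : is_variety (induced [set x])) :
  K0_eq (K0_class (Variety hx)) (K0_one k).
Proof.
apply: K0_trans (K0_point k); apply: K0_iso.
have hxx (_ : affine_space k 0) : [set x] x by [].
exists (fun=> 0), (lift_set hxx); split.
- exact: is_morphism_cst.
- by apply: is_morphism_lift; exact: is_morphism_cst.
- by move=> y; apply: val_inj; rewrite /=; have -> := set_valP y.
- by move=> a; apply/rowP => -[].
Qed.

End ProjectiveVariety.

(** * Computations in the Grothendieck ring *)

Lemma K0_mul0 (k : closedFieldType) (a : K0_expr k) :
  K0_eq (K0_mul a (K0_zero k)) (K0_zero k).
Proof.
apply: K0_trans (K0_mulC _ _) _; set z := K0_mul _ a.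
(* From [z + z = z], adding the opposite of [z] gives [z = 0]. *)
have zz : K0_eq (K0_add z z) z.
  apply: K0_trans (K0_sym (K0_mulDl _ _ _)) _.
  by apply: K0_mul_congr (K0_refl _); exact: K0_add0.
apply: K0_trans (K0_sym (K0_add0 _)) _.
apply: K0_trans (K0_add_congr (K0_sym (K0_addN z)) (K0_refl _)) _.
apply: K0_trans (K0_sym (K0_addA _ _ _)) _.
apply: K0_trans (K0_add_congr (K0_refl _) zz) _.
exact: K0_addN.
Qed.

(** One step of the filtration: [y] is the class of the smaller closed set, [z] that of the stratum
    removed from [x]. *)
Lemma K0_add_Lefschetz (k : closedFieldType) (x y z a b : K0_expr k) :
  K0_eq x (K0_add y z) ->
  K0_eq y (K0_add (K0_one k) (K0_mul (Lefschetz k) a)) ->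
  K0_eq z (K0_mul (Lefschetz k) b) ->
  K0_eq x (K0_add (K0_one k) (K0_mul (Lefschetz k) (K0_add a b))).
Proof.
move=> xyz ya zb; apply: K0_trans xyz _.
apply: K0_trans (K0_add_congr ya zb) _.
apply: K0_trans (K0_sym (K0_addA _ _ _)) _.
apply: K0_add_congr; first exact: K0_refl.
apply: K0_trans (K0_add_congr (K0_mulC _ _) (K0_mulC _ _)) _.
by apply: K0_trans (K0_sym (K0_mulDl _ _ _)) _; exact: K0_mulC.
Qed.

Lemma L_rational_one_add (k : closedFieldType) (X : variety k) a :
  K0_eq (K0_class X) (K0_add (K0_one k) (K0_mul (Lefschetz k) a)) ->
  L_rational X.
Proof.
move=> Xa; exists a.
apply: K0_trans (K0_add_congr Xa (K0_refl _)) _.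
apply: K0_trans (K0_addC _ _) _.
apply: K0_trans (K0_addA _ _ _) _.
apply: K0_trans (K0_add_congr (K0_addN _) (K0_refl _)) _.
exact: K0_add0.
Qed.

(** * Closed cones with a point as vertex *)

Section Cone.
Variables (k : closedFieldType) (n : nat).
Local Notation vec := 'rV[k]_n.+1.
Local Notation P := (projective_space k n).
Variables (X : set P) (v : vec) (i0 : 'I_n.+1).
Hypotheses (cX : closed X) (v1 : v 0 i0 = 1) (Xv : X (line v)).
Hypothesis X_cone : forall (a : vec) c,
  a != 0 -> a + c *: v != 0 -> X (line a) -> X (line (a + c *: v)).

(* The common zeros of the forms [w j] are the multiples of [v]. *)
Let w (j : 'I_n.+1) : mpoly n.+1 k :=
  mpolyX k (mnm1 j) - v 0 j *: mpolyX k (mnm1 i0).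

Let homog_w j : homog 1 (w j).
Proof. by rewrite /homog rpredB ?rpredZ //; exact: homogX. Qed.

Let meval_w (a : vec) j : meval (a 0) (w j) = a 0 j - v 0 j * a 0 i0.
Proof. by rewrite mevalB mevalZ !mevalXU. Qed.

(** The linear form [w j] vanishes at [v] because [v 0 i0 = 1]. *)
Let meval_w_translate (a : vec) c j :
  meval ((a + c *: v) 0) (w j) = meval (a 0) (w j).
Proof.
rewrite !meval_w !mxE v1 mulr1 mulrDr opprD addrACA [c * _]mulrC subrr.
by rewrite addr0.
Qed.

(** The form [w i0] is zero, so [T i0] and [T i0.+1] coincide; that stratum and its chart are empty,
    a case the general argument covers. *)
Let T (j : nat) : set P :=
  X `&` \bigcap_(i in [set i : 'I_n.+1 | (i < j)%N])
    [set x | proj_eval (w i) x = 0].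

Let T_closed j : closed (T j).
Proof.
apply: closedI => //; apply: closed_bigI => i _; exact: proj_closed_zero.
Qed.

Let T0 : T 0 = X.
Proof. by apply/setIidPl => x _ i. Qed.

Let TS (j : 'I_n.+1) : T j.+1 = T j `&` [set x | proj_eval (w j) x = 0].
Proof.
apply/seteqP; split=> x; rewrite /T /=.
  move=> [Xx h]; split; last by apply: h => /=.
  by split=> // i /= ij; apply: h; exact: ltnW.
move=> [[Xx h] wx]; split=> // i; rewrite /= ltnS leq_eqVlt => /predU1P[e|].
  by have -> : i = j by exact: val_inj.
exact: h.
Qed.

Let v0 : v != 0.
Proof. by apply: contra_eq_neq v1 => ->; rewrite mxE eq_sym oner_neq0. Qed.

Let T_last : T n.+1 = [set line v].
Proof.
apply/seteqP; split=> [x [Xx h]|_ ->]; last first.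
  split=> // i _; apply/eqP; rewrite /= (proj_eval_line_eq0 (homog_w i) v0).
  by rewrite meval_w v1 mulr1 subrr.
(* All [w i] vanish at the generator, so its coordinate at [i] is [v 0 i] times the one at [i0]. *)
have e : rep x = rep x 0 i0 *: v.
  apply/rowP => i; apply/eqP; rewrite mxE mulrC -subr_eq0 -meval_w.
  by apply/eqP; apply: (h i); exact: ltn_ord.
have := rep_neq0 x; rewrite e scaler_eq0 negb_or => /andP[c0 _].
by rewrite /= -[LHS]line_rep e lineZ.
Qed.

(** Translation along [v] changes no [w i], and it preserves [X] by the cone property. *)
Let chart_translate (j : 'I_n.+1) (a : vec) c :
  chart (T j) (w j) a -> chart (T j) (w j) (a + c *: v).
Proof.
move=> [aw [Xa h]]; have a0 := linear_form_eq1_neq0 (homog_w j) aw.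
have avw : meval ((a + c *: v) 0) (w j) = 1 by rewrite meval_w_translate.
have av0 := linear_form_eq1_neq0 (homog_w j) avw.
split=> //; split; first exact: X_cone.
move=> i /h /eqP /=; rewrite (proj_eval_line_eq0 (homog_w i) a0) => wa.
apply/eqP; rewrite (proj_eval_line_eq0 (homog_w i) av0).
by rewrite meval_w_translate.
Qed.

Lemma cone_L_rational (hX : is_variety (induced X)) : L_rational (Variety hX).
Proof.
(* Induction on the number [d] of forms still to be imposed. The claim ranges over all proofs [hT],
   since a class formally carries one; [K0_iso] passes between them. *)
suff H d j : (j + d)%N = n.+1 -> forall hT : is_variety (induced (T j)),
    exists a, K0_eq (K0_class (Variety hT))
      (K0_add (K0_one k) (K0_mul (Lefschetz k) a)).
  have hT : is_variety (induced (T 0)) by rewrite T0.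
  have [a Ha] := H n.+1 0%N erefl hT.
  apply: (@L_rational_one_add _ _ a); apply: K0_trans Ha; apply: K0_iso.
  by rewrite /= T0; exact: isomorphic_refl.
elim: d j => [j|d ih j]; rewrite ?addn0 ?addnS.
  (* With all forms imposed only the vertex is left, of class 1. *)
  move=> -> hT; exists (K0_zero k).
  have h1 : is_variety (induced [set line v]) by rewrite -T_last.
  apply: (@K0_trans _ _ (K0_one k)).
    apply: K0_trans (K0_proj_point h1); apply: K0_iso => /=.
    by rewrite T_last; exact: isomorphic_refl.
  apply: K0_sym.
  apply: K0_trans (K0_add_congr (K0_refl _) (K0_mul0 _)) _.
  by apply: K0_trans (K0_addC _ _) _; exact: K0_add0.
move=> jd hT.
have jn : (j < n.+1)%N by rewrite -jd ltnS leq_addr.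
pose J := Ordinal jn.
have cB := proj_closed_zero (homog_w J).
set B := [set x | _] in cB.
have hB : is_variety (induced (T j `&` B)).
  by apply: proj_closed_variety; exact: closedI.
have BC : T j `&` ~` B = T j `&` [set x | proj_eval (w J) x != 0].
  by congr (_ `&` _); apply/seteqP; split=> x /= /eqP.
have hBC : is_variety (induced (T j `&` ~` B)).
  split; last exact: proj_subset_separated.
  rewrite BC; apply: affine_prevariety.
  exact: chart_affine_variety (@T_closed j) (homog_w J).
have cZ := chart_closed (@T_closed j) (homog_w J).
have hZ := affine_closed_variety cZ.
have hZ0 : is_variety (induced (chart (T j) (w J) `&`
    [set a | (a : vec) 0 i0 = 0])).
  apply: affine_closed_variety; apply: closedI => //.
  have -> : [set a : affine_space k n.+1 | (a : vec) 0 i0 = 0] =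
      [set a | forall p, [set mpolyX k (mnm1 i0)] p ->
        meval ((a : vec) 0) p = 0].
    by apply/seteqP; split=> b /= h; [move=> _ ->|move: (h _ erefl)];
      rewrite mevalXU.
  exact: affine_closed_zeros.
have [a Ha] := ih j.+1 jd (proj_closed_variety (@T_closed j.+1)).
(* The coefficient for [T j.+1] is increased by the class of the slice of the chart. *)
exists (K0_add a (K0_class (Variety hZ0))).
apply: K0_add_Lefschetz
  (K0_scissor_subset hT hB hBC (@proj_point_separating k n) cB) _ _.
- apply: K0_trans Ha; apply: K0_iso; rewrite /= (TS J).
  exact: isomorphic_refl.
- apply: K0_trans (K0_cylinder v1 (@chart_translate J) hZ hZ0).
  apply: K0_iso; rewrite /= BC.
  exact: chart_isomorphic.
Qed.

End Cone.

(** * Unions of hyperplanes *)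

Lemma linear_forms_common_zero (k : closedFieldType) (n l : nat)
    (p : 'I_l -> mpoly n.+1 k) : (l <= n)%N -> (forall i, homog 1 (p i)) ->
  exists2 v : 'rV[k]_n.+1, v != 0 & forall i, meval (v 0) (p i) = 0.
Proof.
move=> ln hp.
(* Row [i] holds the values of the forms at the [i]-th basis vector, so common zeros form the left
   kernel, non-zero because the rank is at most [l < n.+1]. *)
pose A : 'M[k]_(n.+1, l) :=
  \matrix_(i, j) meval ((delta_mx 0 i : 'rV_n.+1) 0) (p j).
have : kermx A != 0.
  rewrite -mxrank_eq0 mxrank_ker -lt0n subn_gt0 ltnS.
  exact: leq_trans (rank_leq_col A) ln.
move=> /rowV0Pn[v /sub_kermxP vA v0]; exists v => // j.
have /rowP/(_ j) := vA; rewrite !mxE => <-.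
pose f (a : 'rV[k]_n.+1) := meval (a 0) (p j).
have fL : linear_for *%R f by exact: meval_linear_form.
have f0 : f 0 = 0 by have := fL (-1) 0 0; rewrite scaler0 addr0 mulN1r addNr.
have fD a b : f (a + b) = f a + f b by have := fL 1 a b; rewrite scale1r mul1r.
rewrite -[LHS]/(f v) [v in LHS]row_sum_delta (big_morph f fD f0).
by apply: eq_bigr => i _; rewrite mxE -[_ *: _]addr0 fL f0 addr0.
Qed.

Theorem proposition2p1 (k : closedFieldType) (n l : nat)
    (H : 'I_l -> set (projective_space k n)) (X : set (projective_space k n)) :
  [pchar k] =i pred0 -> (1 <= n)%N -> (1 <= l <= n)%N ->
  (forall i, hyperplane (H i)) -> X = \bigcup_i H i ->
  exists hX : is_variety (induced X), L_rational (Variety hX).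
Proof.
move=> _ _ /andP[l_gt0 ln] hH ->.
have /choice[p hp] i : exists p, homog 1 p /\ H i = [set x | proj_eval p x = 0].
  by have [p [_ hp e]] := hH i; exists p.
have homog_p i : homog 1 (p i) by have [] := hp i.
have Hline i (a : 'rV[k]_n.+1) : a != 0 ->
    H i (line a) <-> meval (a 0) (p i) = 0.
  move=> a0; have [_ ->] := hp i; split=> /eqP /=.
    by rewrite (proj_eval_line_eq0 (homog_p i) a0) => /eqP.
  by rewrite -(proj_eval_line_eq0 (homog_p i) a0) => /eqP.
have [u u0 pu] := linear_forms_common_zero ln homog_p.
have [i0 ui0] : exists i, u 0 i != 0.
  apply: contrapT => h; move/eqP: u0; apply; apply/rowP => i.
  by rewrite mxE; apply/eqP; apply: contra_notT h => ?; exists i.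
pose v := (u 0 i0)^-1 *: u.
have v1 : v 0 i0 = 1 by rewrite mxE mulVf.
have v0 : v != 0 by apply: contra_eq_neq v1 => ->; rewrite mxE eq_sym oner_neq0.
have pv i : meval (v 0) (p i) = 0.
  by rewrite (meval_homogZ _ _ (homog_p i)) pu mulr0.
have cX : closed (\bigcup_i H i).
  apply: closed_bigcup; first exact: finite_finset.
  by move=> i _; have [_ ->] := hp i; exact: proj_closed_zero (homog_p i).
exists (proj_closed_variety cX); apply: (cone_L_rational cX v1).
  (* The vertex lies on every hyperplane, and [0 < l] provides one. *)
  by exists (Ordinal l_gt0) => //; apply/Hline.
(* A linear form vanishing at [a] and [v] vanishes at [a + c *: v], so the translate stays in the
   same hyperplane. *)
move=> a c a0 av0 [i _ /(Hline _ _ a0) Ha]; exists i => //; apply/Hline => //.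
rewrite addrC.
have -> := meval_linear_form (homog_p i) c v a.
by rewrite pv mulr0 add0r.
Qed.
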